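(* Let $(M^{2n+s},g)$ be a Riemannian manifold with orthonormal Killing vector fields $\xi_i$ $(i=1,\dots,s)$, and let $\eta^i=g(\xi_i,\cdot)$ be the 1-form dual to $\xi_i$. Suppose that $d\eta^1=\dots=d\eta^s$ and that the Jacobi operators $R_{\xi_i}$ $(i\le s)$ are positive definite on the distribution $\mathcal D=\bigcap_i\ker\eta^i$. Then $M$ is a weak $f$-K-contact manifold with the structural tensors $$f=-\nabla\,\xi_i,\qquad QX=R_{\xi_i}(X)\quad (X\in\mathcal D,\ i=1,\dots,s)$$ (in particular these expressions do not depend on $i$), together with $Q\,\xi_i=\xi_i$.
   Context: Here $n,s\ge1$, $\nabla$ is the Levi-Civita connection of $g$, and $R_{X,Y}Z=(\nabla_X\nabla_Y-\nabla_Y\nabla_X-\nabla_{[X,Y]})Z$ is the curvature tensor. The Jacobi operator in the $\xi_i$-direction is $R_{\xi_i}:X\mapsto R_{X,\xi_i}\,\xi_i$. The notation $f=-\nabla\xi_i$ means $fX=-\nabla_X\xi_i$. The exterior derivative of a 1-form is normalized by $d\eta(X,Y)=\frac12\{X(\eta(Y))-Y(\eta(X))-\eta([X,Y])\}$. A weak metric $f$-structure on a smooth manifold $M^{2n+s}$ is a set $(f,Q,\xi_i,\eta^i,g)$ $(i=1,\dots,s)$, where $f$ is a $(1,1)$-tensor, $Q$ is a nonsingular $(1,1)$-tensor, $\xi_i$ are vector fields (the characteristic vector fields), $\eta^i$ are 1-forms and $g$ is a Riemannian metric, such that $$f^2=-Q+\sum_i\eta^i\otimes\xi_i,\quad \eta^i(\xi_j)=\delta^i_j,\quad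 Q\,\xi_i=\xi_i,$$ the $2n$-dimensional distribution $\mathcal D:=\bigcap_i\ker\eta^i$ is $f$-invariant, and $g(fX,fY)=g(X,QY)-\sum_i\eta^i(X)\,\eta^i(Y)$ for all vector fields $X,Y$. Put $\Phi(X,Y)=g(X,fY)$. The structure is weak $f$-contact if $\Phi=d\eta^1=\dots=d\eta^s$; a weak $f$-contact structure is weak $f$-K-contact if all $\xi_i$ are Killing for $g$. *)

(* Defs.v *)
From HB Require Import structures.
From mathcomp Require Import all_boot all_order all_algebra.
From mathcomp Require Import all_classical all_reals all_analysis.
From mathcomp Require Import ring.

Set Implicit Arguments.
Unset Strict Implicit.
Unset Printing Implicit Defensive.

Import Order.TTheory GRing.Theory Num.Theory.
Import numFieldNormedType.Exports.

Local Open Scope classical_set_scope.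
Local Open Scope ring_scope.

Section SmoothOn.
Variables (R : realType) (m : nat).
Implicit Types (U : set 'rV[R]_m) (h k : 'rV[R]_m -> R).

Fixpoint Ck (n : nat) U h : Prop :=
  (forall x, U x -> {for x, continuous h}) /\
  if n is n'.+1 then
    forall i : 'I_m,
      (forall x, U x -> derivable h x 'e_i) /\
      Ck n' U (fun x => 'D_'e_i h x)
  else True.

Definition smooth_on U h : Prop := forall n, Ck n U h.

Lemma Ck_continuous n U h x : Ck n U h -> U x -> {for x, continuous h}.
Proof. by case: n => [|n] [H _]; apply: H. Qed.

Lemma CkW n U h : Ck n.+1 U h -> Ck n U h.
Proof.
elim: n h => [|n IH] h [Hc Hd]; split=> // i.
have [Hi Hk] := Hd i; split=> //; exact: IH.
Qed.

Lemma near_eq_continuous U h k x : open U -> (forall y, U y -> h y = k y) ->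
  U x -> {for x, continuous h} -> {for x, continuous k}.
Proof.
move=> oU hk Ux hc; have hx := hk x Ux.
have E : h @ x --> k x by rewrite -hx; exact: hc.
have Un : nbhs x U := open_nbhs_nbhs (conj oU Ux).
have hk' : \forall y \near nbhs x, h y = k y.
  by apply: filterS Un => y Uy; rewrite (hk y Uy).
exact: (cvg_trans (near_eq_cvg hk') E).
Qed.

Lemma Ck_ext n U h k : open U -> (forall x, U x -> h x = k x) ->
  Ck n U h -> Ck n U k.
Proof.
move=> oU; elim: n h k => [|n IH] h k hk [Hc Hd].
  split=> //= x Ux; exact: (near_eq_continuous oU hk Ux (Hc x Ux)).
have nE x : U x -> {near x, h =1 k}.
  move=> Ux; have Un : nbhs x U := open_nbhs_nbhs (conj oU Ux).
  by apply: filterS Un => y Uy; rewrite (hk y Uy).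
split=> [x Ux|i]; first exact: (near_eq_continuous oU hk Ux (Hc x Ux)).
have [Hi Hk] := Hd i; split=> [x Ux|].
  exact: (near_eq_derivable (nE x Ux) (Hi x Ux)).
apply: (IH _ _ _ Hk) => x Ux; by apply: near_eq_derive; exact: nE.
Qed.

Lemma Ck_cst n U (a : R) : Ck n U (fun=> a).
Proof.
elim: n a => [|n IH] a; (split=> [x _|]; first exact: cst_continuous) => //.
move=> i; split=> [x _|]; first exact: derivable_cst.
have -> : (fun x : 'rV[R]_m => 'D_'e_i (fun=> a : R^o) x) = (fun=> 0).
  by apply/funext => x; exact: derive_cst.
exact: IH.
Qed.

Lemma CkD n U h k : open U -> Ck n U h -> Ck n U k ->
  Ck n U (fun x => h x + k x).
Proof.
move=> oU; elim: n h k => [|n IH] h k Hh Hk;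
  (split=> [x Ux|]; first exact: (cvgD (Ck_continuous Hh Ux)
                                       (Ck_continuous Hk Ux))) => //.
have [_ hd] := Hh; have [_ kd] := Hk.
move=> i; have [hi hk] := hd i; have [ki kk] := kd i; split=> [x Ux|].
  exact: (derivableD (hi x Ux) (ki x Ux)).
apply: (Ck_ext oU _ (IH _ _ hk kk)) => x Ux.
by rewrite -(deriveD (hi x Ux) (ki x Ux)).
Qed.

Lemma CkM n U h k : open U -> Ck n U h -> Ck n U k ->
  Ck n U (fun x => h x * k x).
Proof.
move=> oU; elim: n h k => [|n IH] h k Hh Hk;
  (split=> [x Ux|]; first exact: (cvgM (Ck_continuous Hh Ux)
                                       (Ck_continuous Hk Ux))) => //.
have [_ hd] := Hh; have [_ kd] := Hk.
move=> i; have [hi hk] := hd i; have [ki kk] := kd i; split=> [x Ux|].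
  exact: (derivableM (hi x Ux) (ki x Ux)).
have := CkD oU (IH _ _ (CkW Hh) kk) (IH _ _ (CkW Hk) hk).
apply: (Ck_ext oU) => x Ux.
by rewrite -[RHS]/('D_'e_i (h * k) x) (deriveM (hi x Ux) (ki x Ux)).
Qed.

End SmoothOn.

Record chart (R : realType) (m : nat) (T : topologicalType) := Chart {
  chart_dom : set T;
  chart_cod : set 'rV[R]_m;
  chart_map : T -> 'rV[R]_m;
  chart_inv : 'rV[R]_m -> T;
  chart_dom_open : open chart_dom;
  chart_cod_open : open chart_cod;
  chart_mapP : forall p, chart_dom p -> chart_cod (chart_map p);
  chart_invP : forall x, chart_cod x -> chart_dom (chart_inv x);
  chart_mapK : forall p, chart_dom p -> chart_inv (chart_map p) = p;
  chart_invK : forall x, chart_cod x -> chart_map (chart_inv x) = x;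
  chart_map_continuous : {within chart_dom, continuous chart_map};
  chart_inv_continuous : {within chart_cod, continuous chart_inv}
}.

Arguments chart_dom_open {R m T}.
Arguments chart_cod_open {R m T}.

Definition chart_compatible (R : realType) (m : nat) (T : topologicalType)
    (c d : chart R m T) : Prop :=
  forall j : 'I_m,
    smooth_on (chart_cod c `&` chart_inv c @^-1` chart_dom d)
              (fun x => chart_map d (chart_inv c x) 0 j).

Record smooth_manifold (R : realType) (m : nat) := SmoothManifold {
  carrier :> topologicalType;
  manifold_hausdorff : hausdorff_space carrier;
  manifold_second_countable : @second_countable carrier;
  atlas : set (chart R m carrier);
  atlas_cover : forall p : carrier, exists2 c, atlas c & chart_dom c p;
  atlas_compatible : forall c d, atlas c -> atlas d -> chart_compatible c d
}.

Section SmoothFunctions.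
Variables (R : realType) (m : nat) (M : smooth_manifold R m).

Definition smooth (h : M -> R) : Prop :=
  forall c, atlas c -> smooth_on (chart_cod c) (h \o chart_inv c).

Definition smooth_pred : {pred (M -> R)} := fun h => `[< smooth h >].

Lemma smooth_subring : subring_closed smooth_pred.
Proof.
have N h : smooth h -> smooth (- h).
  move=> sh c Ac n.
  have := CkM (chart_cod_open c) (Ck_cst n _ (-1)) (sh c Ac n).
  by apply: (Ck_ext (chart_cod_open c)) => x _ /=; rewrite mulN1r.
split.
- by apply/asboolP => c Ac n; exact: Ck_cst.
- move=> h k /asboolP sh /asboolP sk; apply/asboolP => c Ac n.
  exact: (CkD (chart_cod_open c) (sh c Ac n) (N _ sk c Ac n)).
- move=> h k /asboolP sh /asboolP sk; apply/asboolP => c Ac n.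
  exact: (CkM (chart_cod_open c) (sh c Ac n) (sk c Ac n)).
Qed.

HB.instance Definition _ :=
  GRing.isSubringClosed.Build (M -> R) smooth_pred smooth_subring.

Lemma smooth_scaler : scaler_closed smooth_pred.
Proof.
move=> a h /asboolP sh; apply/asboolP => c Ac n.
exact: (CkM (chart_cod_open c) (Ck_cst n _ a) (sh c Ac n)).
Qed.

HB.instance Definition _ :=
  GRing.isScaleClosed.Build R (M -> R) smooth_pred smooth_scaler.

Record smooth_fun := SmoothFun {
  smooth_fun_val :> M -> R;
  smooth_funP : smooth_fun_val \in smooth_pred
}.

HB.instance Definition _ := [isSub for smooth_fun_val].
HB.instance Definition _ := [Choice of smooth_fun by <:].
HB.instance Definition _ :=
  GRing.SubChoice_isSubComPzRing.Build (M -> R) smooth_pred smooth_fun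
    smooth_subring.
HB.instance Definition _ := [SubZmodule_isSubLmodule of smooth_fun by <:].

End SmoothFunctions.

Notation "'C^oo' ( M )" := (smooth_fun M)
  (at level 8, format "'C^oo' ( M )") : type_scope.

(** A vector field is a derivation of C^oo(M); the fields form a C^oo(M)-module.
   C^oo(M) is a [comPzRingType] (not an nzRing) since M may be empty. *)

Section VectorFields.
Variables (R : realType) (m : nat) (M : smooth_manifold R m).

Record vector_field := VectorField {
  vf_fun :> C^oo(M) -> C^oo(M);
  vf_linear : forall (a : R) (h k : C^oo(M)),
    vf_fun (a *: h + k) = a *: vf_fun h + vf_fun k;
  vf_leibniz : forall h k : C^oo(M),
    vf_fun (h * k) = vf_fun h * k + h * vf_fun k
}.

Lemma vf_ext (X Y : vector_field) : (forall h, X h = Y h) -> X = Y.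
Proof.
case: X => X XD XM; case: Y => Y YD YM /= XY.
have {}XY : X = Y by apply/funext.
by subst Y; congr VectorField; exact: Prop_irrelevance.
Qed.

HB.instance Definition _ := gen_eqMixin vector_field.
HB.instance Definition _ := gen_choiceMixin vector_field.

Program Definition vf_zero : vector_field := @VectorField (fun=> 0) _ _.
Next Obligation. by move=> * /=; rewrite scaler0 addr0. Qed.
Next Obligation. by move=> * /=; rewrite mul0r mulr0 addr0. Qed.

Program Definition vf_add (X Y : vector_field) : vector_field :=
  @VectorField (fun h => X h + Y h) _ _.
Next Obligation. by move=> * /=; rewrite !vf_linear scalerDr addrACA. Qed.
Next Obligation. by move=> * /=; rewrite !vf_leibniz mulrDl mulrDr addrACA. Qed.

Program Definition vf_opp (X : vector_field) : vector_field :=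
  @VectorField (fun h => - X h) _ _.
Next Obligation. by move=> * /=; rewrite vf_linear opprD scalerN. Qed.
Next Obligation. by move=> * /=; rewrite vf_leibniz opprD mulNr mulrN. Qed.

Fact vf_addA : associative vf_add.
Proof. by move=> X Y Z; apply: vf_ext => h /=; rewrite addrA. Qed.
Fact vf_addC : commutative vf_add.
Proof. by move=> X Y; apply: vf_ext => h /=; rewrite addrC. Qed.
Fact vf_add0 : left_id vf_zero vf_add.
Proof. by move=> X; apply: vf_ext => h /=; rewrite add0r. Qed.
Fact vf_addN : left_inverse vf_zero vf_opp vf_add.
Proof. by move=> X; apply: vf_ext => h /=; rewrite addNr. Qed.

HB.instance Definition _ :=
  GRing.isZmodule.Build vector_field vf_addA vf_addC vf_add0 vf_addN.

Lemma smooth_scaleAl (a : R) (h k : C^oo(M)) : a *: (h * k) = (a *: h) * k.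
Proof. by apply/val_inj/funext => p /=; rewrite -[LHS]/(_ * _) mulrA. Qed.

Lemma smooth_scaleAr (a : R) (h k : C^oo(M)) : a *: (h * k) = h * (a *: k).
Proof. by rewrite mulrC smooth_scaleAl mulrC. Qed.

Program Definition vf_scale (h : C^oo(M)) (X : vector_field) : vector_field :=
  @VectorField (fun k => h * X k) _ _.
Next Obligation. by move=> * /=; rewrite vf_linear mulrDr smooth_scaleAr. Qed.
Next Obligation. by move=> * /=; rewrite vf_leibniz mulrDr mulrA mulrCA. Qed.

Fact vf_scaleA h k X : vf_scale h (vf_scale k X) = vf_scale (h * k) X.
Proof. by apply: vf_ext => l /=; rewrite mulrA. Qed.
Fact vf_scale1 : left_id 1 vf_scale.
Proof. by move=> X; apply: vf_ext => l /=; rewrite mul1r. Qed.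
Fact vf_scaleDr : right_distributive vf_scale +%R.
Proof. by move=> h X Y; apply: vf_ext => l /=; rewrite mulrDr. Qed.
Fact vf_scaleDl X : {morph vf_scale^~ X : h k / h + k >-> h + k}.
Proof. by move=> h k; apply: vf_ext => l /=; rewrite mulrDl. Qed.

HB.instance Definition _ := GRing.Zmodule_isLmodule.Build C^oo(M) vector_field
  vf_scaleA vf_scale1 vf_scaleDr vf_scaleDl.

Program Definition bracket (X Y : vector_field) : vector_field :=
  @VectorField (fun h => X (Y h) - Y (X h)) _ _.
Next Obligation. by move=> X Y a h k /=; rewrite !vf_linear scalerBr opprD addrACA. Qed.
Next Obligation.
move=> X Y h k /=.
have vfD (Z : vector_field) h1 k1 : Z (h1 + k1) = Z h1 + Z k1.
  by rewrite -[h1]scale1r vf_linear !scale1r.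
rewrite !vf_leibniz !vfD !vf_leibniz.
ring.
Qed.

End VectorFields.

Section RiemannianGeometry.
Variables (R : realType) (m : nat) (M : smooth_manifold R m).
Local Notation VF := (vector_field M).

(** The value of X at p is the tangent vector h |-> (X h)(p).  On a Hausdorff
    manifold every tangent vector at p is the value at p of some global field,
    so pointwise conditions on T_pM are stated by ranging over global fields. *)
Definition vanishes_at (X : VF) (p : M) : Prop := forall h : C^oo(M), X h p = 0.

(** Tensor fields are C^oo(M)-multilinear maps on vector fields. *)
Definition one_form := {scalar VF}.
Definition tensor11 := {linear VF -> VF}.

(** The last two fields say that g induces an inner product on each T_pM. *)
Record riemannian_metric := RiemannianMetric {
  metric_fun :> VF -> VF -> C^oo(M);
  metric_linear : forall (h : C^oo(M)) X Y Z,
    metric_fun (h *: X + Y) Z = h * metric_fun X Z + metric_fun Y Z;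
  metric_sym : forall (X Y : VF), metric_fun X Y = metric_fun Y X;
  metric_ge0 : forall (X : VF) (p : M), 0 <= metric_fun X X p;
  metric_eq0 : forall (X : VF) (p : M), metric_fun X X p = 0 <-> vanishes_at X p
}.

Record is_levi_civita (g : riemannian_metric) (nabla : VF -> VF -> VF) : Prop :=
  IsLeviCivita {
  conn_linear : forall (h : C^oo(M)) X Y Z,
    nabla (h *: X + Y) Z = h *: nabla X Z + nabla Y Z;
  conn_add : forall (X Y Z : VF), nabla X (Y + Z) = nabla X Y + nabla X Z;
  conn_leibniz : forall (h : C^oo(M)) X Y,
    nabla X (h *: Y) = X h *: Y + h *: nabla X Y;
  conn_torsion_free : forall (X Y : VF), nabla X Y - nabla Y X = bracket X Y;
  conn_metric : forall (X Y Z : VF), X (g Y Z) = g (nabla X Y) Z + g Y (nabla X Z)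
}.

Definition curvature (nabla : VF -> VF -> VF) (X Y Z : VF) : VF :=
  nabla X (nabla Y Z) - nabla Y (nabla X Z) - nabla (bracket X Y) Z.

Definition jacobi (nabla : VF -> VF -> VF) (xi X : VF) : VF :=
  curvature nabla X xi xi.

(** L_xi g = 0. *)
Definition killing (g : riemannian_metric) (xi : VF) : Prop :=
  forall (X Y : VF), xi (g X Y) = g (bracket xi X) Y + g X (bracket xi Y).

Definition ext_d (eta : one_form) (X Y : VF) : C^oo(M) :=
  (2%:R^-1 : R) *: (X (eta Y) - Y (eta X) - eta (bracket X Y)).

Section Structures.
Variable s : nat.
Implicit Types (eta : 'I_s -> one_form) (xi : 'I_s -> VF).

Definition in_D eta (X : VF) : Prop := forall i, eta i X = 0.
Definition in_D_at eta (p : M) (X : VF) : Prop := forall i, eta i X p = 0.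

Definition positive_definite_on_D (g : riemannian_metric) eta
    (A : VF -> VF) : Prop :=
  forall (p : M) (X : VF), in_D_at eta p X -> ~ vanishes_at X p -> 0 < g (A X) X p.

(** Q_p is a nonsingular endomorphism of the finite-dimensional T_pM. *)
Definition nonsingular (Q : tensor11) : Prop :=
  forall (p : M) (X : VF), vanishes_at (Q X) p -> vanishes_at X p.

(** On a (2n+s)-manifold, D has rank 2n as a consequence of [wfs_dual]. *)
Record weak_metric_f_structure (f Q : tensor11) xi eta
    (g : riemannian_metric) : Prop := WeakMetricFStructure {
  wfs_nonsingular : nonsingular Q;
  wfs_sqr : forall (X : VF), f (f X) = - Q X + \sum_(i < s) eta i X *: xi i;
  wfs_dual : forall i j, eta i (xi j) = (i == j)%:R;
  wfs_Qxi : forall i, Q (xi i) = xi i;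
  wfs_invariant : forall (X : VF), in_D eta X -> in_D eta (f X);
  wfs_metric : forall (X Y : VF),
    g (f X) (f Y) = g X (Q Y) - \sum_(i < s) eta i X * eta i Y
}.

Definition fundamental_form (g : riemannian_metric) (f : tensor11)
    (X Y : VF) : C^oo(M) :=
  g X (f Y).

Definition weak_f_contact (f Q : tensor11) xi eta (g : riemannian_metric) : Prop :=
  weak_metric_f_structure f Q xi eta g /\
  forall i X Y, fundamental_form g f X Y = ext_d (eta i) X Y.

Definition weak_f_K_contact (f Q : tensor11) xi eta (g : riemannian_metric) : Prop :=
  weak_f_contact f Q xi eta g /\ forall i, killing g (xi i).

End Structures.
End RiemannianGeometry.

(* Main.v *)
(** For a Killing field xi of unit length with dual form eta one has
    d eta (X, Y) = g (nabla_X xi, Y), so equality of the d eta^i forces all the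
    nabla xi_i to coincide; put f = - nabla xi_i.  It is skew, and it kills each
    xi_j since unit Killing fields have geodesic orbits.  The flow of xi preserves
    both g and d eta, hence [xi, f X] = f [xi, X]; with nabla_xi xi = 0 this turns
    the Jacobi operator into R_xi = - f^2.  So Q = - f^2 + sum eta^i (x) xi_i
    has all the required properties: nonsingularity follows because
    g (Q X, X) = |f X|^2 + sum eta^i(X)^2, where |f X|^2 = g (R_xi X, X) is
    positive on D. *)

Require Import Defs.
From HB Require Import structures.
From mathcomp Require Import all_boot all_order all_algebra.
From mathcomp Require Import all_classical all_reals all_analysis.
From mathcomp Require Import ring lra.

Set Implicit Arguments.
Unset Strict Implicit.
Unset Printing Implicit Defensive.

Import Order.TTheory GRing.Theory Num.Theory.
Local Open Scope ring_scope.

Section VectorFieldTheory.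
Variables (R : realType) (m : nat) (M : smooth_manifold R m).
Local Notation VF := (vector_field M).
Implicit Types (X Y Z : VF) (h k : C^oo(M)).

Lemma smooth_fun_ext h k : (forall p, h p = k p) -> h = k.
Proof. by move=> hk; apply/val_inj/funext. Qed.

Lemma smooth_half_double h : (2%:R^-1 : R) *: (h + h) = h.
Proof.
apply: smooth_fun_ext => p; rewrite -[LHS]/(2%:R^-1 * (h p + h p)).
by field.
Qed.

Lemma smooth_double_eq0 h : h + h = 0 -> h = 0.
Proof. by move=> h2; rewrite -[h]smooth_half_double h2 scaler0. Qed.

Lemma vf_funD X h k : X (h + k) = X h + X k.
Proof. by rewrite -[h]scale1r vf_linear !scale1r. Qed.

Lemma vf_fun0 X : X 0 = 0.
Proof. by apply: (addrI (X 0)); rewrite -vf_funD !addr0. Qed.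

Lemma vf_funN X h : X (- h) = - X h.
Proof. by apply: (addrI (X h)); rewrite -vf_funD !addrN vf_fun0. Qed.

Lemma vf_funZ X (a : R) h : X (a *: h) = a *: X h.
Proof. by rewrite -[a *: h]addr0 vf_linear vf_fun0 addr0. Qed.

Lemma vf_fun1 X : X 1 = 0.
Proof.
apply: (addrI (X 1)).
by rewrite addr0 -[in RHS](mulr1 1) vf_leibniz mulr1 mul1r.
Qed.

Lemma bracketC X Y : bracket X Y = - bracket Y X.
Proof. by apply: vf_ext => h /=; rewrite opprB. Qed.

Lemma bracketxx X : bracket X X = 0.
Proof. by apply: vf_ext => h /=; rewrite subrr. Qed.

Lemma bracket_jacobi X Y Z :
  bracket X (bracket Y Z) = bracket (bracket X Y) Z + bracket Y (bracket X Z).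
Proof. by apply: vf_ext => h /=; rewrite !vf_funD !vf_funN; ring. Qed.

End VectorFieldTheory.

Section MetricTheory.
Variables (R : realType) (m : nat) (M : smooth_manifold R m).
Variable g : riemannian_metric M.
Local Notation VF := (vector_field M).
Implicit Types (X Y Z : VF) (h : C^oo(M)).

Lemma metricC X Y : g X Y = g Y X.
Proof. exact: Defs.metric_sym. Qed.

Lemma metricDl X Y Z : g (X + Y) Z = g X Z + g Y Z.
Proof. by rewrite -[X]scale1r metric_linear scale1r mul1r. Qed.

Lemma metric0l X : g 0 X = 0.
Proof. by apply: (addrI (g 0 X)); rewrite -metricDl !addr0. Qed.

Lemma metricNl X Y : g (- X) Y = - g X Y.
Proof. by apply: (addrI (g X Y)); rewrite -metricDl !addrN metric0l. Qed.

Lemma metricZl h X Y : g (h *: X) Y = h * g X Y.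
Proof. by rewrite -[h *: X]addr0 metric_linear metric0l addr0. Qed.

Lemma metricDr X Y Z : g X (Y + Z) = g X Y + g X Z.
Proof. by rewrite !(metricC X) metricDl. Qed.

Lemma metricNr X Y : g X (- Y) = - g X Y.
Proof. by rewrite !(metricC X) metricNl. Qed.

Lemma metricZr h X Y : g X (h *: Y) = h * g X Y.
Proof. by rewrite !(metricC X) metricZl. Qed.

Lemma metric_sumr (I : finType) X (F : I -> VF) :
  g X (\sum_i F i) = \sum_i g X (F i).
Proof.
apply: (big_morph (fun Y => g X Y)) => [Y Z|]; first exact: metricDr.
by rewrite metricC metric0l.
Qed.

Lemma metric_inj X Y : (forall Z, g Z X = g Z Y) -> X = Y.
Proof.
move=> XY; apply/subr0_eq/vf_ext => h; apply: smooth_fun_ext => p.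
suff : vanishes_at (X - Y) p by apply.
by apply/(metric_eq0 g); rewrite metricDr metricNr XY subrr.
Qed.

(** A pointwise Cauchy-Schwarz argument. It lets a field that is zero only at [p] be paired with
    another one there, as nonsingularity of [Q] requires. *)
Lemma metric_vanishes X Y p : vanishes_at X p -> g X Y p = 0.
Proof.
move=> /(metric_eq0 g) gX0.
(* The vector (|Y|^2 + 1) X - <X, Y> Y has squared length
   - <X, Y>^2 (|Y|^2 + 2) at p. *)
have := metric_ge0 g ((g Y Y + 1) *: X - g X Y *: Y) p.
rewrite metricDl metricNl !metricDr !metricNr !metricZl !metricZr.
rewrite (metricC Y X).
set a := g X Y; set b := g Y Y; set c := g X X.
rewrite -[smooth_fun_val _ p]/((b p + 1) * ((b p + 1) * c p)
   - (b p + 1) * (a p * a p) - (a p * ((b p + 1) * a p)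
   - a p * (a p * b p))).
have := metric_ge0 g Y p; rewrite -/b gX0 => b0 ge0.
have {}ge0 : 0 <= - (b p + 2%:R) * (a p) ^+ 2.
  by move: ge0; congr (0 <= _); ring.
apply/eqP; rewrite -sqrf_eq0 eq_le sqr_ge0 andbT.
by rewrite -oppr_ge0; nra.
Qed.

End MetricTheory.

Section LeviCivitaTheory.
Variables (R : realType) (m : nat) (M : smooth_manifold R m).
Variable g : riemannian_metric M.
Variable nabla : vector_field M -> vector_field M -> vector_field M.
Hypothesis hnabla : is_levi_civita g nabla.
Local Notation VF := (vector_field M).
Implicit Types (X Y Z : VF) (h : C^oo(M)).

Lemma connDl X Y Z : nabla (X + Y) Z = nabla X Z + nabla Y Z.
Proof. by rewrite -[X]scale1r (conn_linear hnabla) !scale1r. Qed.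

Lemma conn0l X : nabla 0 X = 0.
Proof. by apply: (addrI (nabla 0 X)); rewrite -connDl !addr0. Qed.

Lemma connNl X Y : nabla (- X) Y = - nabla X Y.
Proof. by apply: (addrI (nabla X Y)); rewrite -connDl !addrN conn0l. Qed.

Lemma conn0r X : nabla X 0 = 0.
Proof. by apply: (addrI (nabla X 0)); rewrite -(conn_add hnabla) !addr0. Qed.

Section Killing.
Variable xi : VF.
Hypothesis hxi : killing g xi.

(** Writing the brackets with [xi] through [nabla] by torsion-freeness, the [nabla xi] terms cancel
    against metric compatibility; Killing's equation is what remains. *)
Lemma killing_skew X Y : g (nabla X xi) Y = - g X (nabla Y xi).
Proof.
have := hxi X Y; rewrite (conn_metric hnabla) -!(conn_torsion_free hnabla).
rewrite metricDl metricDr metricNl metricNr => E.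
apply: subr0_eq; rewrite opprK.
rewrite -[RHS](subrr (g (nabla xi X) Y + g X (nabla xi Y))) {2}E; ring.
Qed.

(** Differentiating the constant squared length makes each [nabla X xi] orthogonal to [xi]; skewness
    transfers this to [nabla xi xi] against every [X]. *)
Lemma killing_geodesic : g xi xi = 1 -> nabla xi xi = 0.
Proof.
move=> xi1; apply: (@metric_inj _ _ _ g) => X.
have gX : g (nabla X xi) xi = 0.
  apply: smooth_double_eq0.
  by rewrite {2}(metricC g (nabla X xi) xi) -(conn_metric hnabla) xi1 vf_fun1.
by rewrite -[LHS]opprK -killing_skew gX oppr0 metricC metric0l.
Qed.

Variable eta : one_form M.
Hypothesis heta : forall X, eta X = g xi X.

(** Torsion-freeness leaves the antisymmetrization of [g (nabla X xi) Y]; skewness makes it twice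
    this term, which the factor 1/2 in [ext_d] offsets. *)
Lemma killing_ext_d X Y : ext_d eta X Y = g (nabla X xi) Y.
Proof.
rewrite /ext_d !heta !(conn_metric hnabla) -(conn_torsion_free hnabla).
rewrite metricDr metricNr (metricC g (nabla Y xi) X).
rewrite -[g X (nabla Y xi)]opprK -killing_skew.
rewrite -[RHS]smooth_half_double; congr (_ *: _).
ring.
Qed.

(* The Lie derivative along xi commutes with d and annihilates eta, because
   xi is Killing and [xi, xi] = 0. *)
Lemma killing_ext_d_invariant X Y :
  xi (ext_d eta X Y) = ext_d eta (bracket xi X) Y + ext_d eta X (bracket xi Y).
Proof.
have Leta Z : eta (bracket xi Z) = xi (eta Z).
  by rewrite !heta hxi bracketxx metric0l add0r.
rewrite /ext_d vf_funZ -scalerDr; congr (_ *: _).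
rewrite !vf_funD !vf_funN -!Leta bracket_jacobi !linearD /= !Leta.
ring.
Qed.

(** Expand [xi (g (nabla X xi) Z)] by invariance of [g] and by invariance of [ext_d eta]: the terms
    with [bracket xi Z] agree, and nondegeneracy removes [Z]. *)
Lemma killing_bracket_conn X :
  bracket xi (nabla X xi) = nabla (bracket xi X) xi.
Proof.
apply: (@metric_inj _ _ _ g) => Z.
have := killing_ext_d_invariant X Z; rewrite !killing_ext_d hxi.
rewrite [RHS]addrC (metricC g (nabla X xi) (bracket xi Z)).
by rewrite [LHS]addrC => /addrI; rewrite !(metricC g Z).
Qed.

(** Geodesic orbits remove the first curvature term. Torsion-freeness and [killing_bracket_conn]
    split the second, whose bracket part cancels the third. *)
Lemma jacobi_killing X :
  g xi xi = 1 -> jacobi nabla xi X = - nabla (nabla X xi) xi.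
Proof.
move=> xi1; rewrite /jacobi /curvature (killing_geodesic xi1) conn0r sub0r.
have -> : nabla xi (nabla X xi) =
    nabla (bracket xi X) xi + nabla (nabla X xi) xi.
  by rewrite -killing_bracket_conn -(conn_torsion_free hnabla) subrK.
by rewrite (bracketC X) (connNl (bracket xi X)) opprK opprD addrAC addNr add0r.
Qed.

End Killing.
End LeviCivitaTheory.

Theorem theorem4p2 (R : realType) (n s : nat) (hn : (0 < n)%N) (hs : (0 < s)%N)
    (M : smooth_manifold R (2 * n + s)) (g : riemannian_metric M)
    (nabla : vector_field M -> vector_field M -> vector_field M)
    (hnabla : is_levi_civita g nabla)
    (xi : 'I_s -> vector_field M) (eta : 'I_s -> one_form M)
    (hkilling : forall i, killing g (xi i))
    (horthonormal : forall i j, g (xi i) (xi j) = (i == j)%:R)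
    (heta : forall i X, eta i X = g (xi i) X)
    (hd : forall i j X Y, ext_d (eta i) X Y = ext_d (eta j) X Y)
    (hjacobi : forall i, positive_definite_on_D g eta (jacobi nabla (xi i))) :
  exists f Q : tensor11 M,
    [/\ forall i X, f X = - nabla X (xi i),
        forall i X, in_D eta X -> Q X = jacobi nabla (xi i) X,
        forall i, Q (xi i) = xi i
      & weak_f_K_contact f Q xi eta g].
Proof.
pose i0 := Ordinal hs.
have indep i X : nabla X (xi i) = nabla X (xi i0).
  apply: (metric_inj (g := g)) => Z; rewrite !(metricC g Z).
  by rewrite -!(killing_ext_d hnabla (hkilling _) (heta _)) (hd _ i0).
have unit_xi i : g (xi i) (xi i) = 1 by rewrite horthonormal eqxx.
(* By [indep], the mixed derivative reduces to [nabla (xi i) (xi i)]. *)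
have nabla_xi i : nabla (xi i) (xi i0) = 0.
  by rewrite -(indep i) (killing_geodesic hnabla).
have f_linear : linear (fun X => - nabla X (xi i0)).
  by move=> h X Y; rewrite (conn_linear hnabla) opprD scalerN.
pose fM := GRing.isLinear.Build _ _ _ _ _ f_linear.
pose f : tensor11 M := HB.pack (fun X => - nabla X (xi i0)) fM.
have fE X : f X = - nabla X (xi i0) by [].
have f_skew X Y : g (f X) Y = - g X (f Y).
  by rewrite !fE metricNl metricNr (killing_skew hnabla).
have f_xi i : f (xi i) = 0 by rewrite fE nabla_xi oppr0.
(* The whole image of [f] lies in D, so D is [f]-invariant. *)
have eta_f i X : eta i (f X) = 0.
  by rewrite heta -[LHS]opprK -f_skew f_xi metric0l oppr0.
have jacobiE i X : jacobi nabla (xi i) X = - f (f X).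
  rewrite (jacobi_killing hnabla (hkilling i) (heta i)) //.
  by rewrite !indep !fE (connNl hnabla) opprK.
have Q_linear : linear (fun X => - f (f X) + \sum_i eta i X *: xi i).
  move=> h X Y; rewrite !linearP /= scalerDr addrACA.
  congr (_ + _); rewrite scaler_sumr -big_split /=; apply: eq_bigr => i _.
  by rewrite linearP scalerDl scalerA.
pose QM := GRing.isLinear.Build _ _ _ _ _ Q_linear.
pose Q : tensor11 M :=
  HB.pack (fun X => - f (f X) + \sum_i eta i X *: xi i) QM.
have QE X : Q X = - f (f X) + \sum_i eta i X *: xi i by [].
have eta_xi i j : eta i (xi j) = (i == j)%:R by rewrite heta horthonormal.
have Q_xi i : Q (xi i) = xi i.
  rewrite QE f_xi linear0 oppr0 add0r (bigD1 i) //= eta_xi eqxx scale1r.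
  rewrite big1 ?addr0 // => j ji.
  by rewrite eta_xi (negPf ji) scale0r.
(* Used twice: for the metric axiom, and with equal arguments for nonsingularity. *)
have gQ X Y : g X (Q Y) = g (f X) (f Y) + \sum_i eta i X * eta i Y.
  rewrite QE metricDr metricNr f_skew; congr (_ + _).
  rewrite metric_sumr; apply: eq_bigr => i _.
  by rewrite metricZr mulrC !heta (metricC g X).
exists f, Q; split=> //.
- by move=> i X; rewrite indep.
- move=> i X DX; rewrite QE jacobiE big1 ?addr0 // => j _.
  by rewrite DX scale0r.
split=> //; split; last first.
  move=> i X Y; rewrite /fundamental_form -[LHS]opprK -f_skew fE -(indep i).
  by rewrite metricNl opprK (killing_ext_d hnabla (hkilling i) (heta i)).
split=> //.
- move=> p X QX0.
  (* At [p] this is a sum of nonnegative terms equal to zero, so each term vanishes. *)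
  have := metric_vanishes g X QX0; rewrite metricC gQ.
  have sumE : (\sum_i eta i X * eta i X) p = \sum_i (eta i X p) ^+ 2.
    exact: (big_morph (fun h : C^oo(M) => h p)).
  rewrite -[LHS]/(g (f X) (f X) p + (\sum_i eta i X * eta i X) p) sumE.
  move=> /eqP; rewrite paddr_eq0 ?metric_ge0 ?sumr_ge0 //; last first.
    by move=> i _; exact: sqr_ge0.
  move=> /andP[/eqP fX0]; rewrite psumr_eq0 => [/allP etaX0|i _]; last first.
    exact: sqr_ge0.
  (* A nonzero value of [X] at [p] would lie in D, where positivity of the Jacobi operator
     contradicts [fX0]. *)
  apply: contrapT => nX.
  have DX : in_D_at eta p X.
    by move=> i; apply/eqP; rewrite -sqrf_eq0; apply: etaX0 (mem_index_enum i).
  have := hjacobi i0 p X DX nX.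
  by rewrite jacobiE metricNl f_skew opprK fX0 ltxx.
- by move=> X; rewrite QE opprD opprK subrK.
- by move=> X _ i.
- by move=> X Y; rewrite gQ addrK.
Qed.
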